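(* Let $\mathscr X$, $\widehat x$, $x^*$ and $\omega$ be as in the context. Then: (a) $\displaystyle\limsup_{h\downarrow0}\max_{0\le t\le 1-h}\frac{|\widehat x(t+h)-\widehat x(t)|}{\omega(h)}=1$. (b) $\displaystyle\limsup_{h\downarrow0}\sup_{x\in\mathscr X}\max_{0\le t\le 1-h}\frac{|x(t+h)-x(t)|}{\omega(h)}=\sqrt2$, and moreover $\displaystyle\limsup_{h\downarrow0}\max_{0\le t\le 1-h}\frac{|x^*(t+h)-x^*(t)|}{\omega(h)}=\sqrt2$.
   Context: The Faber--Schauder functions are $e_{0,0}(t):=(\min\{t,1-t\})^+$ and $e_{m,k}(t):=2^{-m/2}e_{0,0}(2^m t-k)$ for $t\in\mathbb R$, $m\ge1$, $k\in\mathbb Z$. $\mathscr X$ denotes the set of all functions $x\in C[0,1]$ of the form $x=\sum_{m=0}^\infty\sum_{k=0}^{2^m-1}\theta_{m,k}e_{m,k}$ (uniformly convergent series) with $\theta_{m,k}\in\{-1,+1\}$. Define $\widehat x:=\sum_{m=0}^\infty\sum_{k=0}^{2^m-1}e_{m,k}$ and $x^*:=e_{0,0}+\sum_{m=1}^\infty\Big(\sum_{k=0}^{2^{m-1}-1}e_{m,k}-\sum_{\ell=2^{m-1}}^{2^m-1}e_{m,\ell}\Big)$. For $h>0$ let $\nu(h):=\lfloor-\log_2 h\rfloor$ and $\omega(h):=\big(1+\frac1{\sqrt2}\big)h2^{\nu(h)/2}+\frac13(\sqrt8+2)2^{-\nu(h)/2}$. *)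

(* Defs.v *)
From HB Require Import structures.
From mathcomp Require Import all_boot all_order all_algebra.
From mathcomp Require Import all_classical all_reals all_analysis.
Set Implicit Arguments. Unset Strict Implicit. Unset Printing Implicit Defensive.
Import Order.TTheory GRing.Theory Num.Theory.
Import numFieldNormedType.Exports.
Local Open Scope classical_set_scope.
Local Open Scope ring_scope.

Section FS.
Variable R : realType.

Definition e00 (t : R) : R := Num.max (Num.min t (1 - t)) 0.

Definition fs (m k : nat) (t : R) : R :=
  (2 : R) `^ (- (m%:R / 2)) * e00 (2 ^+ m * t - k%:R).

Definition fs_level (theta : nat -> nat -> R) (m : nat) (t : R) : R :=
  \sum_(k < 2 ^ m) theta m k * fs m k t.

Definition fs_series (theta : nat -> nat -> R) (t : R) : R :=
  limn (fun n => \sum_(m < n) fs_level theta m t).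

Definition scrX : set (R -> R) :=
  [set fs_series theta | theta in
     [set th : nat -> nat -> R | forall m k, th m k = 1 \/ th m k = -1]].

Definition xhat : R -> R := fs_series (fun _ _ => 1).

Definition xstar : R -> R :=
  fs_series (fun m k => if m == 0%N then 1
                        else if (k < 2 ^ m.-1)%N then 1 else -1).

Definition nu (h : R) : int := Num.floor (- (ln h / ln 2)).

Definition omega (h : R) : R :=
  (1 + (Num.sqrt 2)^-1) * h * (2 : R) `^ ((nu h)%:~R / 2)
  + 3^-1 * (Num.sqrt 8 + 2) * (2 : R) `^ (- ((nu h)%:~R / 2)).

Definition modq (f : R -> R) (h : R) : \bar R :=
  ereal_sup [set ((`|f (t + h) - f t| / omega h)%:E) | t in `[0, 1 - h]].

End FS.

(* Main.v *)
Require Import Defs.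
From HB Require Import structures.
From mathcomp Require Import all_boot all_order all_algebra.
From mathcomp Require Import all_classical all_reals all_analysis.
From mathcomp Require Import ring lra.
Set Implicit Arguments. Unset Strict Implicit. Unset Printing Implicit Defensive.
Import Order.TTheory GRing.Theory Num.Theory.
Import numFieldNormedType.Exports.
Local Open Scope classical_set_scope.
Local Open Scope ring_scope.

(** Write r = sqrt 2, c = (2 + r) / 3 and M = nu h - 1; then
    omega h = (1 + r) r^M h + c r^-M.  The m-th level of the series is Lipschitz
    with constant r^m, and the levels from M on sum up to at most c r^-M in
    absolute value.  Splitting the series at level M bounds the increments of
    xhat by omega h, since its tail is nonnegative; splitting at level M + 1 and
    counting the tail twice bounds those of an arbitrary x by r * omega h.  Both
    bounds are asymptotically attained at h = 2^-M / 3: by xhat on [0, h], and by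
    xstar on the interval of length h centred at 1/2. *)

(** * The tent function and its periodic extension *)

Section Tent.
Variable R : realType.
Implicit Types s t u : R.

Lemma e00_ge0 t : 0 <= e00 t.
Proof. by rewrite /e00 le_max lexx orbT. Qed.

Lemma e00_le t : 0 <= t -> e00 t <= t.
Proof. by move=> t0; rewrite /e00 ge_max t0 andbT ge_min lexx. Qed.

Lemma e00_le1B t : t <= 1 -> e00 t <= 1 - t.
Proof. by move=> t1; rewrite /e00 ge_max subr_ge0 t1 andbT ge_min lexx orbT. Qed.

Lemma e00_le_half t : e00 t <= 2^-1.
Proof.
rewrite /e00 ge_max ge_min; apply/andP; split; last by lra.
by case: (leP t 2^-1) => //= ?; lra.
Qed.

Lemma e00_left t : 0 <= t <= 2^-1 -> e00 t = t.
Proof. by move=> t01; rewrite /e00 min_l ?max_l //; lra. Qed.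

Lemma e00_right t : 2^-1 <= t <= 1 -> e00 t = 1 - t.
Proof. by move=> t01; rewrite /e00 min_r ?max_l //; lra. Qed.

Lemma e00_le0 t : t <= 0 -> e00 t = 0.
Proof. by move=> t0; rewrite /e00 max_r // ge_min t0. Qed.

Lemma e00_ge1 t : 1 <= t -> e00 t = 0.
Proof. by move=> t1; rewrite /e00 max_r // ge_min subr_le0 t1 orbT. Qed.

Lemma e00_sym t : e00 (1 - t) = e00 t.
Proof. by rewrite /e00 subKr minC. Qed.

Lemma e00_lipschitz s t : `|e00 s - e00 t| <= `|s - t|.
Proof.
rewrite /e00 /Num.max /Num.min.
case: (ltP s (1 - s)) => hs; case: (ltP t (1 - t)) => ht;
case: ltP => hs'; case: ltP => ht'; rewrite ?subrr ?normr0 //;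
case: (ger0P (s - t)) => hst; rewrite ler_norml; lra.
Qed.

Definition frac s : R := s - (Num.floor s)%:~R.

Lemma frac_itv s : 0 <= frac s < 1.
Proof.
have := floor_itv s; rewrite /frac intrD mulr1z => /andP[? ?].
by apply/andP; split; lra.
Qed.

(* Distance to the nearest integer, periodic on the whole line. *)
Definition tent s : R := e00 (frac s).

Lemma tent_ge0 s : 0 <= tent s. Proof. exact: e00_ge0. Qed.

Lemma tent_le_half s : tent s <= 2^-1. Proof. exact: e00_le_half. Qed.

Lemma tent_le_dist s (z : int) : tent s <= `|s - z%:~R|.
Proof.
have /andP[f0 f1] := frac_itv s.
have [zs|sz] := leP z%:~R s.
  have : (z%:~R : R) <= (Num.floor s)%:~R by rewrite ler_int floor_ge_int.
  by have := e00_le f0; rewrite /tent ger0_norm ?subr_ge0 // {2}/frac; lra.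
have : ((Num.floor s + 1)%:~R : R) <= z%:~R.
  by rewrite ler_int lezD1 floor_lt_int.
have := e00_le1B (ltW f1).
by rewrite intrD mulr1z /tent ltr0_norm ?subr_lt0 // {2}/frac; lra.
Qed.

(** Doubling sends the midpoint of the unit cell of [s] to the odd integer [2 * floor s + 1], and
    the distance from [2 * s] to that integer is exactly [1 - 2 * tent s]. *)
Lemma tent_double s : tent (2 * s) <= 1 - 2 * tent s.
Proof.
have /andP[f0 f1] := frac_itv s.
have := tent_le_dist (2 * s) (2 * Num.floor s + 1).
have -> : 2 * s - (2 * Num.floor s + 1)%:~R = 2 * frac s - 1 :> R.
  by rewrite intrD intrM mulr1z /frac; ring.
move=> /le_trans; apply.
rewrite /tent; case: (leP (frac s) 2^-1) => fs.
  by rewrite e00_left ?f0 // ler0_norm; lra.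
by rewrite e00_right ?(ltW f1) ?(ltW fs) // ger0_norm; lra.
Qed.

(** Within one unit cell the weight is constant and [e00] is 1-Lipschitz. Otherwise integers
    separate [s] from [t], and the two tents are at most the distances to the nearest separating
    integers, which add up to at most [t - s] whatever the weights. *)
Lemma weighted_tent_lipschitz (w : int -> R) s t :
  (forall z, `|w z| <= 1) -> s <= t ->
  `|w (Num.floor s) * tent s - w (Num.floor t) * tent t| <= t - s.
Proof.
move=> w1 st; have [e|ne] := eqVneq (Num.floor s) (Num.floor t).
  rewrite /tent /frac e -mulrBr normrM.
  apply: (@le_trans _ _ (1 * `|s - t|)).
    apply: ler_pM => //; apply: (le_trans (e00_lipschitz _ _)).
    by rewrite opprB addrA subrK.
  by rewrite mul1r distrC ger0_norm ?subr_ge0.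
have lt : (Num.floor s < Num.floor t)%R by rewrite lt_neqAle ne le_floor.
have hst : ((Num.floor s)%:~R + 1 : R) <= (Num.floor t)%:~R.
  by rewrite -[1]mulr1z -intrD ler_int lezD1.
have /andP[s0 s1] := frac_itv s; have /andP[t0 t1] := frac_itv t.
have bnd u : `|w (Num.floor u) * tent u| <= tent u.
  by rewrite normrM (ger0_norm (tent_ge0 u)) ler_piMl ?tent_ge0.
apply: (le_trans (ler_normB _ _)); apply: (le_trans (lerD (bnd s) (bnd t))).
have := e00_le1B (ltW s1); have := e00_le t0; rewrite /tent {2 4}/frac; lra.
Qed.

(* The tents of one level have disjoint supports. *)
Lemma sum_e00 (N : nat) (th : nat -> R) (s : R) :
  \sum_(k < N) th k * e00 (s - k%:R) =
  (\sum_(k < N | Posz k == Num.floor s) th k) * tent s.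
Proof.
rewrite [in RHS]big_mkcond mulr_suml /=; apply: eq_bigr => k _.
case: eqP => [e|ne]; first by rewrite /tent /frac -e.
rewrite mul0r; have /andP[f0 f1] := floor_itv s.
have [ks|sk] := leP (k%:R) s; last by rewrite e00_le0 ?mulr0 // subr_le0 ltW.
rewrite e00_ge1 ?mulr0 //.
have kf : Posz k <= Num.floor s by rewrite floor_ge_int.
have : ((Posz k + 1)%:~R : R) <= (Num.floor s)%:~R.
  by rewrite ler_int lezD1 lt_neqAle kf andbT; apply/eqP.
by rewrite intrD mulr1z -pmulrn; lra.
Qed.

Lemma sum_pick_le1 (N : nat) (th : nat -> R) (z : int) :
  (forall k, `|th k| <= 1) -> `|\sum_(k < N | Posz k == z) th k| <= 1.
Proof.
move=> th1; case: (pickP (fun k : 'I_N => Posz k == z)) => [k /eqP kz|none].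
  rewrite (big_pred1 k) // => j; rewrite -kz.
  by apply/eqP/eqP => [[/ord_inj]|->].
by rewrite big_pred0 // normr0.
Qed.

End Tent.

(** * Slopes and sizes of the levels *)

Section Levels.
Variable R : realType.
Implicit Types (s t h : R) (th : nat -> nat -> R).
Local Notation r := (Num.sqrt (2 : R)).
Local Notation bounded1 th := (forall m k, `|th m k| <= 1).

Lemma sqrt2_sqr : r * r = 2.
Proof. by rewrite -expr2 sqr_sqrtr. Qed.

Lemma sqrt2_gt1 : 1 < r.
Proof. by rewrite -[ltLHS]sqrtr1 ltr_sqrt // ltr1n. Qed.

Lemma sqrt2V : r^-1 = r / 2.
Proof.
have r0 : r != 0 by rewrite gt_eqF ?sqrtr_gt0.
by apply: (mulfI r0); rewrite mulfV // mulrA sqrt2_sqr mulfV.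
Qed.

Lemma sqrt2X_gt0 (m : nat) : 0 < r ^+ m.
Proof. by rewrite exprn_gt0 // sqrtr_gt0. Qed.

Lemma sqrt2X_sqr (m : nat) : r ^+ m * r ^+ m = 2 ^+ m.
Proof. by rewrite -exprMn sqrt2_sqr. Qed.

Lemma powR2_half (m : nat) : (2 : R) `^ (m%:R / 2) = r ^+ m.
Proof. by rewrite mulrC powRrM powR12_sqrt // powR_mulrn // sqrtr_ge0. Qed.

Lemma fsE m k t : fs m k t = r ^- m * e00 (2 ^+ m * t - k%:R).
Proof. by rewrite /fs powRN powR2_half. Qed.

Lemma fs_ge0 m k t : 0 <= fs m k t.
Proof. by rewrite fsE mulr_ge0 ?e00_ge0 // invr_ge0 ltW ?sqrt2X_gt0. Qed.

Lemma fs_levelE th m t : fs_level th m t =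
  r ^- m * ((\sum_(k < 2 ^ m | Posz k == Num.floor (2 ^+ m * t)) th m k)
            * tent (2 ^+ m * t)).
Proof.
rewrite -sum_e00 mulr_sumr; apply: eq_bigr => k _.
by rewrite fsE mulrCA.
Qed.

Lemma fs_level_ge0 th m t : (forall k, 0 <= th m k) -> 0 <= fs_level th m t.
Proof. by move=> th0; apply: sumr_ge0 => k _; rewrite mulr_ge0 ?fs_ge0. Qed.

Lemma fs_level_abs th m t : bounded1 th ->
  `|fs_level th m t| <= r ^- m * tent (2 ^+ m * t).
Proof.
move=> th1; rewrite fs_levelE !normrM ger0_norm ?invr_ge0 ?(ltW (sqrt2X_gt0 _)) //.
rewrite ler_pM2l ?invr_gt0 ?sqrt2X_gt0 // (ger0_norm (tent_ge0 _)).
by rewrite ler_piMl ?tent_ge0 // sum_pick_le1.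
Qed.

Lemma fs_level_lipschitz th m s t : bounded1 th -> s <= t ->
  `|fs_level th m t - fs_level th m s| <= r ^+ m * (t - s).
Proof.
move=> th1 st; rewrite !fs_levelE -mulrBr normrM.
rewrite ger0_norm ?invr_ge0 ?(ltW (sqrt2X_gt0 _)) // distrC.
have -> : r ^+ m * (t - s) = r ^- m * (2 ^+ m * t - 2 ^+ m * s).
  by rewrite -mulrBr -sqrt2X_sqr !mulrA mulVf ?mul1r // gt_eqF ?sqrt2X_gt0.
rewrite ler_pM2l ?invr_gt0 ?sqrt2X_gt0 //.
(* The coefficient depends only on the cell of [2 ^+ m * t]; for cells outside [[0, 2 ^ m)] the sum
   is empty and the weight is 0, so the bound holds on the whole line. *)
apply: (@weighted_tent_lipschitz _
  (fun z => \sum_(k < 2 ^ m | Posz k == z) th m k)).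
  by move=> z; apply: sum_pick_le1.
by rewrite ler_pM2l // exprn_gt0.
Qed.

(* The maximum of [xhat], attained at 1/3. *)
Local Notation c := ((2 + r) / 3).

(* If [tent t > 1/3], then [tent (2 t)] is small enough to compensate, so the
   induction advances by two levels at once. *)
Lemma tent_sum_le (n : nat) t :
  \sum_(m < n) r ^- m * tent (2 ^+ m * t) <= c.
Proof.
have r1 := sqrt2_gt1; have rr := sqrt2_sqr.
have r0 : r != 0 by rewrite gt_eqF //; lra.
(* At 1/3 every tent equals 1/3, so the value there is the fixed point of [x = 1/3 + x / r]. *)
have cE : c = 3^-1 + r^-1 * c.
  by apply: (mulfI r0); rewrite mulrDr mulVKf //; lra.
have step k u : \sum_(m < k.+1) r ^- m * tent (2 ^+ m * u) =
    tent u + r^-1 * \sum_(m < k) r ^- m * tent (2 ^+ m * (2 * u)).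
  rewrite big_ord_recl expr0 invr1 !mul1r mulr_sumr; congr (_ + _).
  apply: eq_bigr => i _; rewrite /= /bump /= add1n exprS invfM -mulrA.
  by rewrite exprSr -(mulrA (2 ^+ i)).
suff : forall n t, \sum_(m < n) r ^- m * tent (2 ^+ m * t) <= c /\
    \sum_(m < n.+1) r ^- m * tent (2 ^+ m * t) <= c.
  by move=> /(_ n t)[].
elim=> [|k IH] u.
  rewrite big_ord0 step big_ord0 mulr0 addr0; split; first by lra.
  by have := tent_le_half u; lra.
split; first by case: (IH u).
have [u3|u3] := leP (tent u) 3^-1.
  rewrite step cE lerD // ler_pM2l ?invr_gt0; last by lra.
  by case: (IH (2 * u)).
rewrite step step; have := tent_double u; case: (IH (2 * (2 * u))) => + _.
move: (\sum_(m < k) _) => S Sc.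
rewrite sqrt2V.
move: (tent (2 * u)) (tent u) u3 => b a u3 ab.
have -> : a + r / 2 * (b + r / 2 * S) = a + r / 2 * b + r * r * (S / 4) by lra.
(* Replacing [b] by its bound [1 - 2 * a] leaves [a] with the negative coefficient [1 - r]; the
   extreme case is thus [a = b = 1/3], which gives exactly [c]. *)
have : 0 <= (a - 3^-1) * (r - 1) by apply: mulr_ge0; lra.
have : 0 <= r * (1 - 2 * a - b) by apply: mulr_ge0; lra.
by rewrite rr; lra.
Qed.

(** Self-similarity: the levels from [M] on form [r ^- M] times a full sum at the point
    [2 ^+ M * t]. *)
Lemma tent_tail_le (M n : nat) t :
  \sum_(M <= m < n) r ^- m * tent (2 ^+ m * t) <= c * r ^- M.
Proof.
have [nM|Mn] := leqP n M.
  by rewrite big_geq // mulr_ge0 ?invr_ge0 ?(ltW (sqrt2X_gt0 _)).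
rewrite -{1}[M]add0n big_addn big_mkord mulrC.
have -> : \sum_(i < n - M) r ^- (i + M) * tent (2 ^+ (i + M) * t) =
  r ^- M * \sum_(i < n - M) r ^- i * tent (2 ^+ i * (2 ^+ M * t)).
  rewrite mulr_sumr; apply: eq_bigr => i _.
  by rewrite !exprD invfM mulrCA !mulrA; congr (_ * _); rewrite mulrC.
by rewrite ler_pM2l ?invr_gt0 ?sqrt2X_gt0 ?tent_sum_le.
Qed.

(** The factor is [1 / (r - 1) = 1 + r], as [r * r = 2]. *)
Lemma sqrt2_geometric (M : nat) : \sum_(m < M) r ^+ m = (1 + r) * (r ^+ M - 1).
Proof.
elim: M => [|M IH]; first by rewrite big_ord0 expr0 subrr mulr0.
rewrite big_ord_recr /= IH exprS; have := sqrt2_sqr; move: (r ^+ M) => x rr.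
by ring: rr.
Qed.

(** * Convergence of the series and its increments *)

Definition fs_partial th t : R ^nat := fun n => \sum_(m < n) fs_level th m t.

(** Comparison with a geometric series of ratio [1 / r]; it makes the [limn] in [fs_series] a
    genuine limit at every real point. *)
Lemma is_cvg_fs_partial th t : bounded1 th -> cvgn (fs_partial th t).
Proof.
move=> th1; have -> : fs_partial th t = series (fun m => fs_level th m t).
  by apply/funext => n; rewrite /series /= big_mkord.
apply: normed_cvg; apply: (@series_le_cvg _ _ (geometric 2^-1 r^-1)) => [n|n|n|].
- exact: normr_ge0.
- by rewrite /= mulr_ge0 // exprn_ge0 // invr_ge0 sqrtr_ge0.
- apply: (le_trans (fs_level_abs _ _ th1)); rewrite /= mulrC exprVn ler_pM2r //.
  exact: tent_le_half.
- apply: is_cvg_geometric_series.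
  by rewrite ger0_norm ?invr_ge0 ?sqrtr_ge0 // invf_lt1 ?sqrt2_gt1 // sqrtr_gt0.
Qed.

Lemma fs_series_dist_le th s t (b : R) (N : nat) : bounded1 th ->
  (forall n, (N <= n)%N -> `|fs_partial th t n - fs_partial th s n| <= b) ->
  `|fs_series th t - fs_series th s| <= b.
Proof.
move=> th1 bnd.
have ct := is_cvg_fs_partial (t := t) th1.
have cs := is_cvg_fs_partial (t := s) th1.
have cD : `|fs_partial th t n - fs_partial th s n| @[n --> \oo] -->
    `|fs_series th t - fs_series th s|.
  by apply: cvg_norm; exact: cvgB ct cs.
rewrite -(cvg_lim _ cD) //; apply: limr_le.
  by apply/cvg_ex; eexists; exact: cD.
by exists N => // n; apply: bnd.
Qed.

Lemma fs_partial_split th t (M n : nat) : (M <= n)%N ->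
  fs_partial th t n =
    \sum_(m < M) fs_level th m t + \sum_(M <= m < n) fs_level th m t.
Proof.
move=> Mn; rewrite /fs_partial -!(big_mkord xpredT (fun m => fs_level th m t)).
by rewrite -big_cat_nat.
Qed.

Lemma fs_head_lipschitz th s t (M : nat) : bounded1 th -> s <= t ->
  `|\sum_(m < M) fs_level th m t - \sum_(m < M) fs_level th m s| <=
  (1 + r) * (r ^+ M - 1) * (t - s).
Proof.
move=> th1 st; rewrite -sumrB -sqrt2_geometric mulr_suml.
apply: (le_trans (ler_norm_sum _ _ _)); apply: ler_sum => m _.
exact: fs_level_lipschitz.
Qed.

Lemma fs_tail_abs th t (M n : nat) : bounded1 th ->
  `|\sum_(M <= m < n) fs_level th m t| <= c * r ^- M.
Proof.
move=> th1; apply: le_trans (tent_tail_le M n t).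
apply: (le_trans (ler_norm_sum _ _ _)); apply: ler_sum => m _.
exact: fs_level_abs.
Qed.

Lemma fs_series_dist th s t (M : nat) : bounded1 th -> s <= t ->
  `|fs_series th t - fs_series th s| <=
  (1 + r) * (r ^+ M - 1) * (t - s) + 2 * (c * r ^- M).
Proof.
move=> th1 st; apply: (@fs_series_dist_le _ _ _ _ M) => // n Mn.
rewrite !(fs_partial_split _ _ Mn) opprD addrACA.
apply: (le_trans (ler_normD _ _)); apply: lerD; first exact: fs_head_lipschitz.
rewrite mulrDl mul1r; apply: (le_trans (ler_normB _ _)).
by apply: lerD; apply: fs_tail_abs.
Qed.

(** Both tails lie in [[0, c * r ^- M]], so their difference costs this length once instead of
    twice. *)
Lemma fs_series_dist_nneg th s t (M : nat) :
  bounded1 th -> (forall m k, 0 <= th m k) -> s <= t ->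
  `|fs_series th t - fs_series th s| <=
  (1 + r) * (r ^+ M - 1) * (t - s) + c * r ^- M.
Proof.
move=> th1 th0 st; apply: (@fs_series_dist_le _ _ _ _ M) => // n Mn.
rewrite !(fs_partial_split _ _ Mn) opprD addrACA.
apply: (le_trans (ler_normD _ _)); apply: lerD; first exact: fs_head_lipschitz.
have tail u : 0 <= \sum_(M <= m < n) fs_level th m u <= c * r ^- M.
  have s0 : 0 <= \sum_(M <= m < n) fs_level th m u.
    by apply: sumr_ge0 => m _; apply: fs_level_ge0.
  by rewrite s0 -[X in X <= _](ger0_norm s0) fs_tail_abs.
have /andP[t0 t1] := tail t; have /andP[s0 s1] := tail s.
by rewrite ler_norml; apply/andP; split; lra.
Qed.

End Levels.

(** * Upper bounds in terms of [omega] *)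

Section Bounds.
Variable R : realType.
Implicit Types (s t h : R) (th : nat -> nat -> R).
Local Notation r := (Num.sqrt (2 : R)).
Local Notation c := ((2 + r) / 3).
Local Notation bounded1 th := (forall m k, `|th m k| <= 1).

Lemma ln2_pos : 0 < ln (2 : R).
Proof. by rewrite ln_gt0 // ltr1n. Qed.

(** The shift by one absorbs a factor [r] in each term: [(1 + 1/r) * r = 1 + r] and
    [(2 * r + 2) / r = 2 + r]. *)
Lemma omegaE h (M : nat) : nu h = Posz M.+1 ->
  omega h = (1 + r) * r ^+ M * h + c * r ^- M.
Proof.
move=> nuE; rewrite /omega nuE -pmulrn powRN powR2_half.
have -> : Num.sqrt (8 : R) = 2 * r.
  have -> : 8 = 2 ^+ 2 * 2 :> R by ring.
  by rewrite sqrtrM // sqrtr_sqr ger0_norm.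
have rr := sqrt2_sqr R; have r0 : r != 0 by rewrite gt_eqF ?sqrtr_gt0.
rewrite exprS; have x0 : r ^+ M != 0 by rewrite gt_eqF ?sqrt2X_gt0.
move: (r ^+ M) x0 => x x0.
have -> : 2 * r + 2 = r * (2 + r) by rewrite mulrDr rr; ring.
by field; rewrite x0 r0.
Qed.

Lemma nu_half h : 0 < h <= 2^-1 -> exists M : nat, nu h = Posz M.+1.
Proof.
move=> /andP[h0 h2]; have l2 := ln2_pos.
have : (1 <= nu h)%R.
  rewrite /nu floor_ge_int mulr1z -mulNr ler_pdivlMr // mul1r lerNr.
  by rewrite -lnV ?posrE // ler_ln ?posrE ?invr_gt0.
by case: (nu h) => [[|M]|M] // _; exists M.
Qed.

Lemma omega_gt0 h : 0 < h <= 2^-1 -> 0 < omega h.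
Proof.
move=> h01; have [M /omegaE ->] := nu_half h01; case/andP: h01 => h0 _.
have x0 := sqrt2X_gt0 R M; have r1 := sqrt2_gt1 R.
by rewrite addr_gt0 // !mulr_gt0 ?invr_gt0 //; lra.
Qed.

Lemma fs_series_modulus th s h : bounded1 th -> 0 < h <= 2^-1 ->
  `|fs_series th (s + h) - fs_series th s| <= r * omega h.
Proof.
move=> th1 h01; have [M /omegaE ->] := nu_half h01; case/andP: h01 => h0 _.
apply: (le_trans (fs_series_dist M.+1 th1 _)); first by rewrite lerDl ltW.
have r1 := sqrt2_gt1 R; rewrite [s + h]addrC addrK exprS invfM.
(* Splitting one level later multiplies the head by [r], and the doubled tail gains [2 / r = r] as
   well; the [- 1] of the geometric sum leaves the slack [(1 + r) * h]. *)
have -> : r * ((1 + r) * r ^+ M * h + c * r ^- M) =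
    (1 + r) * (r * r ^+ M - 1) * h + 2 * (c * (r^-1 * r ^- M)) + (1 + r) * h.
  by rewrite sqrt2V; move: (r ^+ M) (r ^- M) => x y; field.
by rewrite lerDl mulr_ge0 //; lra.
Qed.

Lemma fs_series_modulus_nneg th s h :
  bounded1 th -> (forall m k, 0 <= th m k) -> 0 < h <= 2^-1 ->
  `|fs_series th (s + h) - fs_series th s| <= omega h.
Proof.
move=> th1 th0 h01; have [M /omegaE ->] := nu_half h01; case/andP: h01 => h0 _.
apply: (le_trans (fs_series_dist_nneg M th1 th0 _)); first by rewrite lerDl ltW.
have r1 := sqrt2_gt1 R; rewrite [s + h]addrC addrK lerD2r ler_pM2r //.
by rewrite ler_pM2l; lra.
Qed.

Lemma modq_le (f : R -> R) h (l : R) : 0 < h <= 2^-1 ->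
  (forall t, `|f (t + h) - f t| <= l * omega h) -> (modq f h <= l%:E)%E.
Proof.
move=> h01 fl; apply: ge_ereal_sup => _ [t _ <-].
by rewrite lee_fin ler_pdivrMr ?omega_gt0.
Qed.

(* At [h = 2^-M / 3] each level below [M] has full slope at [0] and each level
   from [M] on takes the value of its tent at 1/3. *)
Definition hpt (M : nat) : R := 3^-1 * 2^-1 ^+ M.

Definition hpt_level (M m : nat) : R :=
  if (m < M)%N then r ^+ m * hpt M else r ^- m * 3^-1.

Lemma hpt_gt0 M : 0 < hpt M.
Proof. by rewrite mulr_gt0 ?exprn_gt0 ?invr_gt0. Qed.

Lemma hpt_le_half M : hpt M <= 2^-1.
Proof.
have : 2^-1 ^+ M <= 1 :> R by rewrite exprn_ile1 //; lra.
by rewrite /hpt; lra.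
Qed.

Lemma hptX M m : 2 ^+ m * hpt (m + M) = hpt M.
Proof.
by rewrite /hpt exprD mulrCA (mulrA (2 ^+ m)) -exprMn mulfV // expr1n mul1r.
Qed.

Lemma fs_hpt M m : exists2 k, (k < 2 ^ m)%N & hpt_level M m <= fs m k (hpt M).
Proof.
rewrite /hpt_level; have [mM|Mm] := ltnP m M.
  exists 0%N; first by rewrite expn_gt0.
  rewrite fsE subr0 -(subnKC (ltnW mM)) hptX.
  rewrite e00_left ?hpt_le_half ?(ltW (hpt_gt0 _)) //.
  by rewrite -(hptX (M - m) m) -sqrt2X_sqr -!mulrA mulKf ?gt_eqF ?sqrt2X_gt0.
(* Here [2 ^+ m * hpt M = 2 ^ j / 3], and [k] is its integer part. Since 3 does not divide [2 ^ j],
   the fractional part is 1/3 or 2/3, where [e00] equals 1/3. *)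
set j := (m - M)%N; exists (2 ^ j %/ 3)%N.
  apply: (@leq_trans (2 ^ j)); first by rewrite ltn_Pdiv // expn_gt0.
  by rewrite leq_exp2l // leq_subr.
rewrite fsE ler_pM2l ?invr_gt0 ?sqrt2X_gt0 //.
have -> : 2 ^+ m * hpt M = (2 ^ j)%:R / 3.
  rewrite -[m in LHS](subnK Mm) -/j exprD -mulrA -{2}[M]addn0 hptX /hpt expr0 mulr1.
  by rewrite natrX.
have ndiv : (2 ^ j %% 3 != 0)%N.
  by apply/negP => d; have := d; rewrite -/(dvdn 3 (2 ^ j)) Euclid_dvdX.
rewrite {1}(divn_eq (2 ^ j) 3) natrD natrM mulrDl mulfK // addrC addKr.
have : (2 ^ j %% 3 < 3)%N by rewrite ltn_mod.
move: (2 ^ j %% 3)%N ndiv => [|[|[|//]]] // _ _.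
  by rewrite e00_left //; lra.
by rewrite e00_right; lra.
Qed.

(** Two geometric sums meeting at level [M]; since [(1/3) / (1 - 1/r) = c], the second one tends to
    the extremal tail [c * r ^- M]. *)
Lemma sum_hpt_level M n : \sum_(m < n + M) hpt_level M m =
  (1 + r) * (r ^+ M - 1) * hpt M + c * (1 - r ^- n) * r ^- M.
Proof.
elim: n => [|n IH].
  rewrite expr0 invr1 subrr mulr0 mul0r addr0 -sqrt2_geometric mulr_suml.
  by apply: eq_bigr => i _; rewrite /hpt_level ltn_ord.
rewrite addSn big_ord_recr /= IH /hpt_level ltnNge leq_addl /= exprD exprS.
have rr := sqrt2_sqr R; rewrite !invfM sqrt2V.
move: (r ^- n) (r ^- M) => x y; rewrite -addrA; congr (_ + _).
by field: rr.
Qed.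

(** * Lower bounds at the points [hpt M] *)

Lemma nu_hpt M : nu (hpt M) = Posz M.+1.
Proof.
have l2 := ln2_pos; apply/eqP; rewrite /nu floor_eq -pmulrn.
have -> : (Posz M.+1 + 1)%:~R = M%:R + 2 :> R.
  by rewrite intrD -pmulrn mulr1z -natr1; ring.
have -> : - (ln (hpt M) / ln 2) = M%:R + ln 3 / ln 2.
  rewrite /hpt lnM ?posrE ?exprn_gt0 ?invr_gt0 // lnXn ?invr_gt0 // !lnV ?posrE //.
  by rewrite -mulr_natr; field; rewrite gt_eqF.
(* It remains to place the binary logarithm of 3 in [[1, 2)], that is, [2 <= 3 < 4]. *)
rewrite -[M.+1%:R]natr1 lerD2l ltrD2l ler_pdivlMr // ltr_pdivrMr // mul1r.
rewrite ler_ln ?posrE // ler_nat /=.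
have -> : 2 * ln 2 = ln (2 ^+ 2) :> R by rewrite lnXn // mulr_natl.
by rewrite ltr_ln ?posrE ?exprn_gt0 // -natrX ltr_nat.
Qed.

(** The only loss against [omega] is [(1 + r) * hpt M], a fraction [r ^- M] of the slope term. *)
Lemma omega_hpt M : omega (hpt M) * (1 - r ^- M) <=
  (1 + r) * (r ^+ M - 1) * hpt M + c * r ^- M.
Proof.
rewrite (omegaE (nu_hpt M)); have x0 := sqrt2X_gt0 R M; have r1 := sqrt2_gt1 R.
have xx : r ^+ M * r ^- M = 1 by rewrite mulfV // gt_eqF.
have y0 : 0 < r ^- M by rewrite invr_gt0.
move: (r ^+ M) (r ^- M) (hpt M) x0 xx y0 => x y h x0 xx y0.
have : 0 <= c * y * y by rewrite !mulr_ge0 //; lra.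
have -> : ((1 + r) * x * h + c * y) * (1 - y) =
  (1 + r) * x * h - (1 + r) * (x * y) * h + c * y - c * y * y by ring.
by rewrite xx; lra.
Qed.

(** Letting [n] tend to infinity completes the tail. The gain [a] and the number [k] of skipped
    levels are 1 and 0 for [xhat], [r] and 1 for [xstar]. *)
Lemma fs_series_lower th s t (a : R) (M k : nat) : bounded1 th -> 0 <= a ->
  (forall n, a * \sum_(m < n) hpt_level M m <=
             fs_partial th t (n + k)%N - fs_partial th s (n + k)%N) ->
  a * (1 - r ^- M) * omega (hpt M) <= fs_series th t - fs_series th s.
Proof.
move=> th1 a0 low; rewrite -mulrA (mulrC (1 - _)).
apply: (le_trans (ler_wpM2l a0 (omega_hpt M))).
set head := (1 + r) * (r ^+ M - 1) * hpt M.
have cw : a * (head + c * (1 - r^-1 ^+ n) * r ^- M) @[n --> \oo] -->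
    a * (head + c * (1 - 0) * r ^- M).
  apply: cvgMl_tmp; apply: cvgD; first exact: cvg_cst.
  apply: cvgMr_tmp; apply: cvgMl_tmp; apply: cvgB; first exact: cvg_cst.
  apply: cvg_expr.
  by rewrite ger0_norm ?invr_ge0 ?sqrtr_ge0 // invf_lt1 ?sqrt2_gt1 // sqrtr_gt0.
have cD : fs_partial th t (n + (M + k))%N
    - fs_partial th s (n + (M + k))%N @[n --> \oo] -->
    fs_series th t - fs_series th s.
  apply: cvgB.
    by rewrite (cvg_shiftn (M + k) (fs_partial th t)); exact: is_cvg_fs_partial.
  by rewrite (cvg_shiftn (M + k) (fs_partial th s)); exact: is_cvg_fs_partial.
rewrite subr0 mulr1 in cw.
apply: (ler_cvg_to cw cD); near=> n.
by rewrite exprVn -sum_hpt_level addnA.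
Unshelve. all: by end_near.
Qed.

Lemma le_modq (f : R -> R) h t (l : R) : 0 < h <= 2^-1 -> 0 <= t <= 1 - h ->
  l * omega h <= `|f (t + h) - f t| -> (l%:E <= modq f h)%E.
Proof.
move=> h01 t01 fl; apply: (@le_trans _ _ (`|f (t + h) - f t| / omega h)%:E).
  by rewrite lee_fin ler_pdivlMr ?omega_gt0.
by apply: ereal_sup_ubound; exists t => //=; rewrite in_itv.
Qed.

Lemma ler_sum_term (I : finType) (F : I -> R) i :
  (forall j, 0 <= F j) -> F i <= \sum_j F j.
Proof. by move=> F0; rewrite (bigD1 i) //= lerDl sumr_ge0. Qed.

Lemma hpt_itv M : 0 < hpt M <= 2^-1.
Proof. by rewrite hpt_gt0 hpt_le_half. Qed.

Lemma xhat_lower M : ((1 - r ^- M)%:E <= modq (@xhat R) (hpt M))%E.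
Proof.
have h0 := hpt_gt0 M; have h2 := hpt_le_half M.
(* Every level vanishes at 0, so the increment is the value at [hpt M]; one tent per level suffices,
   the others being nonnegative. *)
apply: (@le_modq _ _ 0); rewrite ?hpt_itv //; first by lra.
rewrite add0r -[_ * _]mul1r mulrA; apply: le_trans (ler_norm _).
apply: (@fs_series_lower _ _ _ _ _ 0) => // [m k|n]; first by rewrite normr1.
rewrite mul1r addn0 /fs_partial -sumrB; apply: ler_sum => m _.
have -> : fs_level (fun _ _ => 1) m (0 : R) = 0.
  by apply: big1 => k _; rewrite fsE e00_le0 ?mulr0 // sub0r oppr_le0.
rewrite subr0; have [k km] := fs_hpt M m; move=> /le_trans; apply.
rewrite -[leLHS]mul1r.
apply: (@ler_sum_term _ (fun k : 'I_(2 ^ m) => 1 * fs m k (hpt M)) (Ordinal km)) => j.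
by rewrite mul1r fs_ge0.
Qed.

(** * The increment of [xstar] across 1/2 *)

Definition star_sign (m k : nat) : R :=
  if m == 0%N then 1 else if (k < 2 ^ m.-1)%N then 1 else -1.

Lemma star_sign_pm1 m k : star_sign m k = 1 \/ star_sign m k = -1.
Proof. by rewrite /star_sign; case: eqP; [left|case: ifP; [left|right]]. Qed.

Lemma pm1_bounded th : (forall m k, th m k = 1 \/ th m k = -1) -> bounded1 th.
Proof. by move=> h m k; case: (h m k) => ->; rewrite ?normrN normr1. Qed.

(** The reflection [k -> 2 ^ m - k - 1] carries tent [k] of level [m] at [h] to a tent of level
    [m + 1] left of 1/2, with sign 1; the tents of sign -1 are supported to the right of 1/2. *)
Lemma fs_star_left m k h : (k < 2 ^ m)%N -> 0 < h ->
  r^-1 * fs m k h <= fs_level star_sign m.+1 ((1 - h) / 2).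
Proof.
move=> km h0; have pm : 0 < 2 ^+ m * h by rewrite mulr_gt0 ?exprn_gt0.
have half : 2 ^+ m.+1 * ((1 - h) / 2) = (2 ^ m)%:R - 2 ^+ m * h.
  by rewrite exprS natrX; field.
have k'm : (2 ^ m - k.+1 < 2 ^ m.+1)%N.
  by rewrite (leq_ltn_trans (leq_subr _ _)) // ltn_exp2l.
have -> : r^-1 * fs m k h = star_sign m.+1 (2 ^ m - k.+1) *
    fs m.+1 (2 ^ m - k.+1) ((1 - h) / 2).
  rewrite /star_sign /= ltn_subrL expn_gt0 /= mul1r !fsE half mulrA -invfM -exprS.
  congr (_ * _); rewrite natrB // -e00_sym -natr1; congr e00; ring.
apply: (@ler_sum_term _ (fun k : 'I_(2 ^ m.+1) =>
  star_sign m.+1 k * fs m.+1 k ((1 - h) / 2)) (Ordinal k'm)) => j.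
rewrite /star_sign /=; case: ltnP => mj; first by rewrite mul1r fs_ge0.
rewrite fsE half e00_le0 ?mulr0 //.
have : ((2 ^ m)%:R : R) <= j%:R by rewrite ler_nat.
by lra.
Qed.

(** As on the left, with the translation [k -> 2 ^ m + k] in place of the reflection; here the tents
    of sign 1 vanish. *)
Lemma fs_star_right m k h : (k < 2 ^ m)%N -> 0 < h ->
  fs_level star_sign m.+1 ((1 - h) / 2 + h) <= - (r^-1 * fs m k h).
Proof.
move=> km h0; have pm : 0 < 2 ^+ m * h by rewrite mulr_gt0 ?exprn_gt0.
have half : 2 ^+ m.+1 * ((1 - h) / 2 + h) = (2 ^ m)%:R + 2 ^+ m * h.
  by rewrite exprS natrX; field.
have k'm : (2 ^ m + k < 2 ^ m.+1)%N by rewrite expnS mul2n -addnn ltn_add2l.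
have -> : r^-1 * fs m k h = - (star_sign m.+1 (2 ^ m + k) *
    fs m.+1 (2 ^ m + k) ((1 - h) / 2 + h)).
  rewrite /star_sign /= ltnNge leq_addr /= mulN1r opprK !fsE half mulrA -invfM.
  rewrite -exprS; congr (_ * _); rewrite natrD; congr e00; ring.
rewrite lerNr -sumrN.
apply: (@ler_sum_term _ (fun k : 'I_(2 ^ m.+1) =>
  - (star_sign m.+1 k * fs m.+1 k ((1 - h) / 2 + h))) (Ordinal k'm)) => j.
rewrite /star_sign /=; case: ltnP => mj; last by rewrite mulN1r opprK fs_ge0.
rewrite fsE half e00_ge1 ?mulr0 ?oppr0 //.
have : (j.+1%:R : R) <= (2 ^ m)%:R by rewrite ler_nat.
by rewrite -natr1; lra.
Qed.

(* On the two sides of 1/2 the levels [m >= 1] of [xstar] are mirror images of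
   [r^-1 * xhat] with opposite signs and level 0 is symmetric, so an increment
   centred at 1/2 equals [2 * r^-1 * xhat h = r * xhat h]. *)
Lemma xstar_lower M : ((r * (1 - r ^- M))%:E <= modq (@xstar R) (hpt M))%E.
Proof.
have h0 := hpt_gt0 M; have h2 := hpt_le_half M.
apply: (@le_modq _ _ ((1 - hpt M) / 2)); rewrite ?hpt_itv //; first by lra.
rewrite distrC; apply: le_trans (ler_norm _).
apply: (@fs_series_lower star_sign _ _ _ _ 1).
- exact/pm1_bounded/star_sign_pm1.
- exact: sqrtr_ge0.
move=> n; rewrite addn1 /fs_partial -sumrB big_ord_recl.
have -> : fs_level star_sign 0 ((1 - hpt M) / 2) -
    fs_level star_sign 0 ((1 - hpt M) / 2 + hpt M) = 0.
  rewrite /fs_level expn0 !big_ord1 !fsE expr0 !mul1r !subr0.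
  have -> : (1 - hpt M) / 2 + hpt M = 1 - (1 - hpt M) / 2 by field.
  by rewrite e00_sym subrr.
rewrite add0r mulr_sumr; apply: ler_sum => m _.
rewrite lift0; have [k km kle] := fs_hpt M m.
have := fs_star_left km h0; have := fs_star_right km h0.
rewrite sqrt2V.
have : r * hpt_level M m <= r * fs m k (hpt M) by rewrite ler_wpM2l ?sqrtr_ge0.
by lra.
Qed.

(** * Upper limits from a uniform bound and a near-extremal sequence *)

Lemma limf_esup_hpt (f : R -> \bar R) (l : R) :
  (forall h, 0 < h <= 2^-1 -> (f h <= l%:E)%E) ->
  (forall M, ((l * (1 - r ^- M))%:E <= f (hpt M))%E) ->
  limf_esup f (0 : R)^'+ = l%:E.
Proof.
move=> up low; apply/eqP; rewrite eq_le; apply/andP; split.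
  apply: (@le_trans _ _ (ereal_sup [set f x | x in [set h | 0 < h <= 2^-1]])).
    apply: ereal_inf_lbound; exists [set h : R | 0 < h <= 2^-1] => //.
    near=> h; apply/andP; split; near: h; first exact: nbhs_right_gt.
    by apply: nbhs_right_le.
  by apply: ge_ereal_sup => _ [h hh <-]; apply: up.
(* Any right neighbourhood [V] of 0 contains some [hpt M] whose defect [l * r ^- M] is below [e]. *)
apply: le_ereal_inf_tmp => _ [V V0 <-]; apply/lee_addgt0Pr => e e0.
have hc : hpt M @[M --> \oo] --> 0.
  rewrite -[0](mulr0 3^-1); apply: cvgMl_tmp; apply: cvg_expr.
  by rewrite ger0_norm //; lra.
have rc : l * r^-1 ^+ M @[M --> \oo] --> 0.
  rewrite -[0](mulr0 l); apply: cvgMl_tmp; apply: cvg_expr.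
  by rewrite ger0_norm ?invr_ge0 ?sqrtr_ge0 // invf_lt1 ?sqrt2_gt1 // sqrtr_gt0.
have [M [VM eM]] : exists M, V (hpt M) /\ `|l * r^-1 ^+ M| < e.
  have A : \forall M \near \oo, 0 < hpt M -> V (hpt M) := hc _ V0.
  have B : \forall M \near \oo, `|l * r^-1 ^+ M| < e.
    by move/cvgr0Pnorm_lt: rc; apply.
  have [M [VM eM]] := filter_ex (filterI A B).
  by exists M; split => //; apply/VM/hpt_gt0.
apply: (@le_trans _ _ (f (hpt M) + e%:E)%E); last first.
  by rewrite leeD2r //; apply: ereal_sup_ubound; exists (hpt M).
apply: (@le_trans _ _ ((l * (1 - r ^- M))%:E + e%:E)%E); last by rewrite leeD2r.
rewrite -EFinD lee_fin; move: eM; rewrite exprVn => /(le_lt_trans (ler_norm _)).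
by lra.
Unshelve. all: by end_near.
Qed.

End Bounds.

Theorem theorem2p3 (R : realType) :
  limf_esup (modq (@xhat R)) (0 : R)^'+ = 1%:E /\
  limf_esup (fun h : R => ereal_sup [set modq x h | x in @scrX R]) (0 : R)^'+
    = (Num.sqrt (2 : R))%:E /\
  limf_esup (modq (@xstar R)) (0 : R)^'+ = (Num.sqrt (2 : R))%:E.
Proof.
(* Membership transfers the upper bound to [xstar], and the lower bound for [xstar] to the
   supremum. *)
have xstarX : scrX (@xstar R) by exists (@star_sign R) => //; apply: star_sign_pm1.
have up x h : scrX x -> 0 < h <= 2^-1 -> (modq x h <= (Num.sqrt (2 : R))%:E)%E.
  move=> [th th1 <-] h01; apply: modq_le => // t.
  by apply: fs_series_modulus => //; apply: pm1_bounded.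
split; last split; apply: limf_esup_hpt.
- move=> h h01; apply: modq_le => // t; rewrite mul1r.
  by apply: fs_series_modulus_nneg => // m k; rewrite normr1.
- by move=> M; rewrite mul1r xhat_lower.
- by move=> h h01; apply: ge_ereal_sup => _ [x xX <-]; apply: up.
- move=> M; apply: (@le_trans _ _ (modq (@xstar R) (hpt R M))).
    exact: xstar_lower.
  by apply: ereal_sup_ubound; exists (@xstar R).
- by move=> h; apply: up.
- by move=> M; apply: xstar_lower.
Qed.
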